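(* For $1\le \ell\le n$ define $$A_{\ell}=\frac1d\,C_1^{\vee \ell}+\cdots+\frac1d\,C_d^{\vee \ell}.$$ Then the Cesàro limit $\lim_{M\to\infty}\frac1M\sum_{m=1}^M A_{\ell}^{\,m}$ of the powers of $A_\ell$ exists and equals $$\Omega_{\ell}=\langle K^{\vee\ell}\rangle=\sum_{k\in\mathcal K}\lambda(k)\,k^{\vee\ell},$$ the average being taken over the kernel $\mathcal K$ of the semigroup $\mathcal S$ generated by $\{C_1,\dots,C_d\}$.
   Context: Zeon powers: for an $n\times n$ matrix $W$ and $1\le \ell\le n$, $W^{\vee \ell}$ is the $\binom n\ell\times\binom n\ell$ matrix with rows and columns indexed by the $\ell$-subsets of $\{1,\dots,n\}$, whose $(\mathrm I,\mathrm J)$ entry is the permanent of the submatrix of $W$ with rows in $\mathrm I$ and columns in $\mathrm J$. (For the matrix of a function $f$, this is the induced action $\{i_1,\dots,i_\ell\}\mapsto\{f(i_1),\dots,f(i_\ell)\}$ on $\ell$-subsets, giving a zero row when $f$ is not injective on the subset.) Setting: $\mathcal A$ is the adjacency matrix of a directed graph on $n$ vertices that is $d$-out-regular, and $A=d^{-1}\mathcal A$ is assumed irreducible and aperiodic. $A=\frac1d(C_1+\cdots+C_d)$, where each $C_i$ is an $n\times n$ binary stochastic matrix (entries $0,1$, exactly one $1$ in each row; i.e. the matrix of a function $f$ on $\{1,\dots,n\}$, with $(i,j)$ entry $1$ iff $f(i)=j$). $\mathcal S$ is the finite semigroup generated by $C_1,\dots,C_d$ under matrix multiplication. Its kernel $\mathcal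 K$ is its minimal (two-sided) ideal, which is the set of elements of $\mathcal S$ of minimal rank. $\mu^{(1)}$ is the probability measure on $\mathcal S$ with $\mu^{(1)}(w)=\frac1d\#\{i: C_i=w\}$, and $\mu^{(m)}$ is its $m$-th convolution power. $\lambda(w)=\lim_{M\to\infty}\frac1M\sum_{m=1}^M\mu^{(m)}(w)$; it is known that this limit exists for every $w\in\mathcal S$ and that $\lambda$ is a probability measure supported on $\mathcal K$. $\langle f(K)\rangle=\sum_{k\in\mathcal K}\lambda(k)f(k)$. *)

(* Defs.v *)
From HB Require Import structures.
From mathcomp Require Import all_boot all_order all_algebra all_fingroup.
From mathcomp Require Import all_classical all_reals all_analysis.

Set Implicit Arguments.
Unset Strict Implicit.
Unset Printing Implicit Defensive.

Import Order.TTheory GRing.Theory Num.Theory.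
Import numFieldNormedType.Exports.

Local Open Scope classical_set_scope.
Local Open Scope ring_scope.

Definition permanent (R : comPzRingType) (m : nat) (W : 'M[R]_m) : R :=
  \sum_(s : 'S_m) \prod_(i < m) W i (s i).

Definition ksub (n l : nat) := {I : {set 'I_n} | #|I| == l}.

Lemma card_ksub (n l : nat) : #|{: ksub n l}| = 'C(n, l).
Proof.
by rewrite card_sub -[n in RHS]card_ord -card_draws cardsE; apply: eq_card.
Qed.

Definition ksub_elt (n l : nat) (I : ksub n l) (a : 'I_l) : 'I_n :=
  enum_val (cast_ord (esym (eqP (valP I))) a).

(* The 'C(n, l) rows and columns are numbered by the enumeration of ksub n l. *)
Definition zeon_power (R : comPzRingType) (n : nat) (W : 'M[R]_n) (l : nat) :
    'M[R]_#|{: ksub n l}| :=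
  \matrix_(p, q)
    permanent (mxsub (ksub_elt (enum_val p)) (ksub_elt (enum_val q)) W).

Definition irreducible_mx (R : realType) (n : nat) (A : 'M[R]_n) : Prop :=
  forall i j, exists2 m : nat, (0 < m)%N & 0 < (A ^+ m) i j.

(* At every vertex, the gcd of the return times is 1. *)
Definition aperiodic_mx (R : realType) (n : nat) (A : 'M[R]_n) : Prop :=
  forall (i : 'I_n) (g : nat),
    (forall m : nat, (0 < m)%N -> 0 < (A ^+ m) i i -> (g %| m)%N) -> g = 1%N.

Definition binary_stochastic (R : realType) (n : nat) (W : 'M[R]_n) : Prop :=
  (forall i j, W i j = 0 \/ W i j = 1) /\ (forall i, exists! j, W i j = 1).

Definition gen_semigroup (R : realType) (n d : nat) (C : 'I_d -> 'M[R]_n) :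
    set 'M[R]_n :=
  [set w | exists s : seq 'I_d, s <> [::] /\ w = \prod_(i <- s) C i].

Definition two_sided_ideal (R : realType) (n : nat) (S I : set 'M[R]_n) : Prop :=
  [/\ I !=set0, I `<=` S &
      forall s x, S s -> I x -> I (s *m x) /\ I (x *m s)].

Definition minimal_ideal (R : realType) (n : nat) (S K : set 'M[R]_n) : Prop :=
  two_sided_ideal S K /\ forall I, two_sided_ideal S I -> I `<=` K -> I = K.

Definition convolution (R : realType) (n : nat) (S : set 'M[R]_n)
    (mu nu : 'M[R]_n -> R) (w : 'M[R]_n) : R :=
  \sum_(uv \in [set uv : 'M[R]_n * 'M[R]_n |
                 [/\ S uv.1, S uv.2 & uv.1 *m uv.2 = w]]) mu uv.1 * nu uv.2.

Definition mu1 (R : realType) (n d : nat) (C : 'I_d -> 'M[R]_n) (w : 'M[R]_n) : R :=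
  d%:R^-1 * #|[pred i | C i == w]|%:R.

(* For m >= 1; the value at m = 0 is never used. *)
Definition mu (R : realType) (n d : nat) (C : 'I_d -> 'M[R]_n) (m : nat) :
    'M[R]_n -> R :=
  iter m.-1 (fun nu => convolution (gen_semigroup C) nu (mu1 C)) (mu1 C).

Definition lambda (R : realType) (n d : nat) (C : 'I_d -> 'M[R]_n) (w : 'M[R]_n) : R :=
  lim ((fun M : nat => M%:R^-1 * \sum_(1 <= m < M.+1) mu C m w) @ \oo).

Definition kernel_average (R : realType) (n p : nat) (d : nat)
    (C : 'I_d -> 'M[R]_n) (K : set 'M[R]_n) (f : 'M[R]_n -> 'M[R]_p) : 'M[R]_p :=
  \sum_(k \in K) lambda C k *: f k.

(* Hence the finitely supported sums above, over subsets of the semigroup or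
   of its square, are genuine sums. *)
Lemma gen_semigroup_finite (R : realType) (n d : nat) (C : 'I_d -> 'M[R]_n) :
  (forall i, binary_stochastic (C i)) -> finite_set (gen_semigroup C).
Proof.
move=> hC; pose F (f : {ffun 'I_n -> 'I_n}) : 'M[R]_n :=
  \matrix_(i, j) (f i == j)%:R.
apply: (@sub_finite_set _ _ (F @` setT)); last exact: finite_image.
move=> _ [s [_ ->]]; elim: s => [|i s [g _ IH]].
  exists [ffun i => i] => //; rewrite big_nil.
  by apply/matrixP => a b; rewrite !mxE ffunE.
have [h01 hu] := hC i.
have /choice[f hf] : forall a, exists b, C i a b = 1.
  by move=> a; have [b [hb _]] := hu a; exists b.
exists [ffun a => g (f a)] => //; rewrite big_cons -IH.
apply/matrixP => a b; rewrite !mxE ffunE (bigD1 (f a)) //= hf mul1r mxE.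
rewrite big1 ?addr0 // => c cf; have [->|h] := h01 a c; first by rewrite mul0r.
have [x [_ hx]] := hu a; move: cf.
by rewrite -(hx _ h) -(hx _ (hf a)) eqxx.
Qed.

(* Main.v *)
Require Import Defs.
From HB Require Import structures.
From mathcomp Require Import all_boot all_order all_algebra all_fingroup.
From mathcomp Require Import all_classical all_reals all_analysis.

(** Every [C i] is the matrix of a self-map [c i] of the vertices, so the
    semigroup they generate sits inside the finite monoid of all self-maps and
    [mu m] is the law at time [m] of the random walk that starts at the identity
    and composes at each step with a uniformly chosen [c i] ([mu_walk]).

    Permanents are not multiplicative in general, but [zeon_power] is
    multiplicative on matrices of functions ([zeon_power_funM]): there it is the
    matrix of the induced partial map on [l]-subsets ([zeon_power_fun]).  Hence
    the [m]-th power of [A_l] is the expectation of the zeon power of the walk at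
    time [m] ([zeon_mean_expr]).  It is a finite linear combination of fixed
    matrices, so its averages converge as soon as those of the coefficients do.

    The coefficients are entries of powers of a stochastic matrix, and the
    averages of the powers of a power-bounded matrix converge: the space is the
    direct sum of the fixed vectors and of the image of [1 - P]
    ([mean_ergodic]).  This makes [lambda] a genuine limit, and an invariant
    measure of the walk.

    What remains is that [lambda] vanishes outside [K].  Being an ideal, [K] is
    never left by the walk, and it can be entered from any element of the
    semigroup by multiplying by a word that represents an element of [K].  An
    invariant measure cannot charge a state from which mass flows into a set that
    returns none of it ([invariant_supported]). *)

Set Implicit Arguments.
Unset Strict Implicit.
Unset Printing Implicit Defensive.

Import Order.TTheory GRing.Theory Num.Theory.
Import numFieldNormedType.Exports.

Local Open Scope classical_set_scope.
Local Open Scope ring_scope.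

(** * Mean ergodic theorem for power-bounded matrices *)

Lemma bounded_mean_cvg0 (R : realType) (u : nat -> R) (b : R) :
  (forall M, `|u M| <= b) -> (fun M : nat => M%:R^-1 * u M) @ \oo --> 0.
Proof.
move=> ub; have b0 : 0 <= b by exact: le_trans (ub 0%N).
apply: norm_cvg0; rewrite -(cvg_shiftS (fun M : nat => `|M%:R^-1 * u M|)).
apply: (@squeeze_cvgr _ _ _ _ (cst 0) (fun M : nat => harmonic M * b)).
- near=> M => /=; rewrite normr_ge0 normrM ger0_norm ?invr_ge0//.
  by rewrite ler_wpM2l ?invr_ge0.
- exact: cvg_cst.
- by rewrite -[X in _ --> X](mul0r b); apply: cvgMr_tmp; exact: cvg_harmonic.
Unshelve. all: by end_near. Qed.

(** A vector that is both fixed by [P] and of the form [y - y P] makes the orbit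
    of [y] drift linearly, [y P^m = y - m v], which boundedness forbids. *)
Lemma power_bounded_ker_im (R : realType) (N : nat) (P : 'M[R]_N) (b : R) :
  (forall m i j, `|(P ^+ m) i j| <= b) ->
  (kermx (1%:M - P) :&: (1%:M - P))%MS = 0.
Proof.
move=> Pb; apply/eqP; rewrite -submx0; apply/row_subP => r.
set v := row r _.
have [/sub_kermxP vZ /submxP [y vy]] : (v <= kermx (1%:M - P))%MS /\
    (v <= 1%:M - P)%MS.
  by apply/andP; rewrite -sub_capmx; exact: row_sub.
have vP : v *m P = v.
  by apply/esym/eqP; rewrite -subr_eq0 -{1}[v]mulmx1 -mulmxBr vZ.
have yP : y *m P = y - v.
  by rewrite vy mulmxBr mulmx1 opprB addrC subrK.
have drift m : y *m (P ^+ m) = y - m%:R *: v.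
  elim: m => [|m IH]; first by rewrite expr0 mulmx1 scale0r subr0.
  rewrite exprSr mulmxA IH mulmxBl yP -scalemxAl vP.
  by rewrite -natr1 scalerDl scale1r opprD addrA addrAC.
suff -> : v = 0 by exact: sub0mx.
apply/rowP => j; rewrite [RHS]mxE; apply/eqP; rewrite -normr_eq0.
apply/negPn/negP => vj0; have {vj0}vj : 0 < `|v 0 j| by rewrite lt0r vj0/=.
(* [c] bounds entry [j] of [y - y P^m] uniformly in [m]. *)
pose c := `|y 0 j| + \sum_i `|y 0 i| * b.
have bnd m : m%:R * `|v 0 j| <= c.
  have -> : m%:R * `|v 0 j| = `|(y - y *m (P ^+ m)) 0 j|.
    by rewrite drift opprB addrC subrK [in RHS]mxE normrM normr_nat.
  rewrite !mxE; apply: (le_trans (ler_normB _ _)); rewrite lerD2l.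
  apply: (le_trans (ler_norm_sum _ _ _)); apply: ler_sum => i _.
  by rewrite normrM ler_wpM2l.
have c0 : 0 <= c / `|v 0 j|.
  by rewrite divr_ge0 ?(le_trans _ (bnd 0%N))// mul0r.
have := archi_boundP c0; rewrite ltr_pdivrMr// => /lt_le_trans /(_ (bnd _)).
by rewrite ltxx.
Qed.

(** Row space = fixed vectors (+) image of [1 - P]: averaging leaves the first
    part alone and telescopes the second. *)
Lemma mean_ergodic (R : realType) (N : nat) (P : 'M[R]_N) (b : R) :
  (forall m i j, `|(P ^+ m) i j| <= b) ->
  exists Q : 'M[R]_N, Q *m P = Q /\
    forall i j, (fun M : nat => M%:R^-1 * \sum_(1 <= m < M.+1) (P ^+ m) i j)
                  @ \oo --> Q i j.
Proof.
move=> Pb.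
have full : row_full (kermx (1%:M - P) + (1%:M - P))%MS.
  rewrite /row_full (mxrank_disjoint_sum (power_bounded_ker_im Pb)) mxrank_ker.
  by rewrite subnK ?rank_leq_row.
have /sub_addsmxP [[U V] /= e1] := submx_full 1%:M full.
pose Q := U *m kermx (1%:M - P).
have QP : Q *m P = Q.
  apply/esym/eqP; rewrite -subr_eq0 -{1}[Q]mulmx1 -mulmxBr -mulmxA mulmx_ker.
  by rewrite mulmx0.
exists Q; split=> // i j.
have QPm m : Q *m (P ^+ m) = Q.
  by elim: m => [|m IH]; rewrite ?mulmx1// exprSr mulmxA IH QP.
have Pm m : P ^+ m = Q + V *m (P ^+ m - P ^+ m.+1).
  rewrite -{1}[P ^+ m]mul1mx e1 mulmxDl -/Q QPm -mulmxA mulmxBl mul1mx.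
  by rewrite exprS.
have sumP M : \sum_(1 <= m < M.+1) (P ^+ m) i j
    = M%:R * Q i j + (V *m (P - P ^+ M.+1)) i j.
  rewrite -summxE (eq_bigr _ (fun m _ => Pm m)) big_split/= sumr_const_nat.
  rewrite subn1 /= -mulmx_sumr (@telescope_sumr_eq _ _ _ (fun m => - P ^+ m))//.
    by rewrite opprK addrC [- _ + _]addrC expr1 [LHS]mxE mulmxnE mulr_natl addrC.
  by move=> k _; rewrite opprK addrC.
have bound M : `|\sum_(1 <= m < M.+1) (P ^+ m) i j - M%:R * Q i j|
    <= \sum_k `|V i k| * (b + b).
  rewrite sumP addrAC subrr add0r mxE.
  apply: (le_trans (ler_norm_sum _ _ _)); apply: ler_sum => k _.
  rewrite normrM ler_wpM2l// !mxE (le_trans (ler_normB _ _))// lerD//.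
  by have := Pb 1%N k j; rewrite expr1.
pose w M := \sum_(1 <= m < M.+1) (P ^+ m) i j - M%:R * Q i j.
have lim0 : (fun M : nat => M%:R^-1 * w M + Q i j) @ \oo --> Q i j.
  rewrite -[X in _ --> X]add0r; apply: cvgD; last exact: cvg_cst.
  exact: bounded_mean_cvg0 bound.
apply: cvg_trans lim0; apply: near_eq_cvg.
(* [M%:R * M%:R^-1 = 1] fails at [M = 0]. *)
by exists 1%N => // M /= M0; rewrite mulrBr mulKf ?subrK// pnatr_eq0 -lt0n.
Qed.

(** * Random walk driven by finitely many equiprobable maps *)

Definition step (R : realType) (T : finType) (d : nat) (act : T -> 'I_d -> T)
    (z y : T) : R :=
  d%:R^-1 * \sum_(i < d) (act z i == y)%:R.

Definition walk_mx (R : realType) (T : finType) (d : nat)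
    (act : T -> 'I_d -> T) : 'M[R]_#|T| :=
  \matrix_(p, q) step R act (enum_val p) (enum_val q).

Definition walk (R : realType) (T : finType) (d : nat) (act : T -> 'I_d -> T)
    (m : nat) (x y : T) : R :=
  (walk_mx R act ^+ m) (enum_rank x) (enum_rank y).

Lemma walk0 (R : realType) (T : finType) (d : nat) (act : T -> 'I_d -> T) x y :
  walk R act 0 x y = (x == y)%:R.
Proof. by rewrite /walk expr0 mxE (inj_eq enum_rank_inj). Qed.

Lemma walkS (R : realType) (T : finType) (d : nat) (act : T -> 'I_d -> T) m x y :
  walk R act m.+1 x y = \sum_z walk R act m x z * step R act z y.
Proof.
rewrite /walk exprSr mxE (reindex enum_rank) /=; last first.
  by apply: onW_bij; exact: enum_rank_bij.
by apply: eq_bigr => z _; rewrite [walk_mx _ _ _ _]mxE !enum_rankK.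
Qed.

(** One step of the walk seen from the test functions: the mean of [g] after the
    step is the mean of its average over the [d] maps before the step. *)
Lemma sum_step (R : realType) (T : finType) (d : nat) (act : T -> 'I_d -> T)
    (V : lmodType R) (p : T -> R) (g : T -> V) :
  \sum_y (\sum_z p z * step R act z y) *: g y
    = \sum_z p z *: (d%:R^-1 *: \sum_(i < d) g (act z i)).
Proof.
under eq_bigr do rewrite scaler_suml.
rewrite exchange_big; apply: eq_bigr => z _.
under eq_bigr do rewrite -scalerA.
rewrite -scaler_sumr /step; congr (_ *: _).
under eq_bigr do rewrite -scalerA scaler_suml.
rewrite -scaler_sumr exchange_big; congr (_ *: _); apply: eq_bigr => i _.
rewrite (bigD1 (act z i))//= eqxx scale1r big1 ?addr0// => y.
by rewrite eq_sym => /negPf->; rewrite scale0r.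
Qed.

Lemma step_ge0 (R : realType) (T : finType) (d : nat) (act : T -> 'I_d -> T) z y :
  0 <= step R act z y.
Proof. by rewrite mulr_ge0 ?invr_ge0// sumr_ge0. Qed.

Lemma walk_ge0 (R : realType) (T : finType) (d : nat) (act : T -> 'I_d -> T)
    m x y : 0 <= walk R act m x y.
Proof.
elim: m y => [|m IH] y; first by rewrite walk0.
by rewrite walkS sumr_ge0// => z _; rewrite mulr_ge0 ?step_ge0.
Qed.

Lemma walk_sum1 (R : realType) (T : finType) (d : nat) (act : T -> 'I_d -> T)
    m x : (0 < d)%N -> \sum_y walk R act m x y = 1.
Proof.
move=> d0; elim: m => [|m IH].
  under eq_bigr do rewrite walk0.
  by rewrite (bigD1 x)//= eqxx big1 ?addr0// => y; rewrite eq_sym => /negPf->.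
have := sum_step act (walk R act m x) (fun=> 1 : R^o).
rewrite (eq_bigr (walk R act m.+1 x)) => [->|y _]; last first.
  by rewrite walkS; exact: mulr1.
rewrite -[RHS]IH; apply: eq_bigr => z _.
rewrite sumr_const card_ord -[X in _ *: X]/(_ * _) mulVf ?pnatr_eq0 -?lt0n//.
exact: mulr1.
Qed.

Lemma walk_le1 (R : realType) (T : finType) (d : nat) (act : T -> 'I_d -> T)
    m x y : (0 < d)%N -> walk R act m x y <= 1.
Proof.
move=> d0; rewrite -(walk_sum1 R act m x d0) (bigD1 y)//= lerDl.
by rewrite sumr_ge0// => z _; exact: walk_ge0.
Qed.

Lemma walk_reach (R : realType) (T : finType) (d : nat) (act : T -> 'I_d -> T)
    m x y : walk R act m x y != 0 ->
  exists s : seq 'I_d, size s = m /\ y = foldl act x s.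
Proof.
elim: m y => [|m IH] y.
  rewrite walk0; case: (x =P y) => [-> _|]; first by exists [::].
  by rewrite eqxx.
rewrite walkS; have [/existsP[z] |] :=
    boolP [exists z, walk R act m x z * step R act z y != 0].
  rewrite mulf_eq0 negb_or => /andP[/IH[s [sm ->]]].
  rewrite mulf_eq0 negb_or => /andP[_ h] _.
  have [/existsP[i /eqP <-]|] := boolP [exists i, act (foldl act x s) i == y].
    by exists (rcons s i); rewrite size_rcons sm foldl_rcons.
  rewrite negb_exists => /forallP no; rewrite big1 ?eqxx// in h.
  by move=> i _; rewrite (negPf (no i)).
rewrite negb_exists => /forallP no; rewrite big1 ?eqxx// => z _.
by apply/eqP; rewrite -[_ == _]negbK.
Qed.

(** Entries of powers of a stochastic matrix lie in [0, 1], so [mean_ergodic]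
    applies; the limit [Q] satisfies [Q P = Q], which makes its rows invariant. *)
Lemma walk_mean_cvg (R : realType) (T : finType) (d : nat)
    (act : T -> 'I_d -> T) x : (0 < d)%N ->
  exists pi : T -> R,
    [/\ forall y, 0 <= pi y,
        forall y, pi y = \sum_z pi z * step R act z y &
        forall y, (fun M : nat => M%:R^-1 * \sum_(1 <= m < M.+1) walk R act m x y)
                    @ \oo --> pi y].
Proof.
move=> d0; have [|Q [QP Qlim]] := @mean_ergodic R _ (walk_mx R act) 1.
  move=> m i j; rewrite -(enum_valK i) -(enum_valK j) -/(walk R act m _ _).
  by rewrite ger0_norm ?walk_ge0 ?walk_le1.
exists (fun y => Q (enum_rank x) (enum_rank y)); split=> y.
- rewrite -(cvg_lim _ (Qlim (enum_rank x) (enum_rank y)))//.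
  apply: limr_ge; first by apply/cvg_ex; eexists; exact: Qlim.
  near=> M; rewrite mulr_ge0 ?invr_ge0// sumr_ge0// => m _.
  by rewrite -/(walk R act m x y) walk_ge0.
- rewrite -{1}QP mxE (reindex enum_rank) /=; last first.
    by apply: onW_bij; exact: enum_rank_bij.
  by apply: eq_bigr => z _; rewrite mxE !enum_rankK.
- exact: Qlim.
Unshelve. all: by end_near. Qed.

(** Invariance makes the mass of [K] constant in time, and none leaves, so none
    may enter: a charged state outside [K] has all its successors outside [K].
    These successors are charged too, hence no word from a charged state outside
    [K] ever reaches [K]. *)
Lemma invariant_supported (R : realType) (T : finType) (d : nat)
    (act : T -> 'I_d -> T) (pi : T -> R) (K : pred T) : (0 < d)%N ->
  (forall y, 0 <= pi y) ->
  (forall y, pi y = \sum_z pi z * step R act z y) ->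
  (forall y i, K y -> K (act y i)) ->
  (forall y, pi y != 0 -> exists s : seq 'I_d, K (foldl act y s)) ->
  forall y, pi y != 0 -> K y.
Proof.
move=> d0 pi0 inv clos reach.
have dV : (0 : R) < d%:R^-1 by rewrite invr_gt0 ltr0n.
(* Change of the mass of [K] due to the mass at [z], per unit of that mass. *)
pose inflow z := d%:R^-1 * \sum_(i < d) (K (act z i))%:R - (K z)%:R : R.
have inflow_ge0 z : 0 <= inflow z.
  rewrite subr_ge0; case: (boolP (K z)) => Kz; last first.
    by rewrite mulr_ge0 ?(ltW dV)// sumr_ge0.
  under eq_bigr do rewrite clos//.
  by rewrite sumr_const card_ord mulVf ?pnatr_eq0 -?lt0n.
have mass : \sum_z pi z * inflow z = 0.
  under eq_bigr do rewrite mulrBr.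
  rewrite sumrB; apply/eqP; rewrite subr_eq0; apply/eqP; symmetry.
  under eq_bigr do rewrite inv.
  exact: (sum_step act pi (fun y => (K y)%:R : R^o)).
have no_entry z i : pi z != 0 -> K (act z i) -> K z.
  move=> piz Kzi; apply: contraT => Kz.
  have /eqP : pi z * inflow z = 0.
    by apply: (psumr_eq0P _ mass) => // t _; rewrite mulr_ge0.
  rewrite mulf_eq0 (negPf piz)/= /inflow (negPf Kz) subr0 => /eqP eq0.
  have : 0 < d%:R^-1 * \sum_(i < d) (K (act z i))%:R :> R.
    by rewrite mulr_gt0// (bigD1 i)//= Kzi ltr_pwDl// sumr_ge0.
  by rewrite eq0 ltxx.
have pi_act z i : pi z != 0 -> pi (act z i) != 0.
  move=> piz; rewrite gt_eqF// inv (bigD1 z)//= ltr_pwDl//.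
    rewrite mulr_gt0 ?lt0r ?piz//= step_ge0 andbT gt_eqF// mulr_gt0//.
    by rewrite (bigD1 i)//= eqxx ltr_pwDl// sumr_ge0.
  by rewrite sumr_ge0// => t _; rewrite mulr_ge0 ?step_ge0.
move=> y piy; have [s] := reach y piy.
elim: s y piy => [|i s IH] y piy //= Ks.
by apply: (no_entry y i piy); apply: IH => //; exact: pi_act.
Qed.

(** * Matrices of functions and their zeon powers *)

Definition fun_mx (R : pzSemiRingType) (n : nat) (f : {ffun 'I_n -> 'I_n}) :
    'M[R]_n := \matrix_(i, j) (f i == j)%:R.

Definition ffun_comp (T : finType) (g f : {ffun T -> T}) : {ffun T -> T} :=
  [ffun a => g (f a)].

Lemma fun_mx_inj (R : nzSemiRingType) (n : nat) : injective (@fun_mx R n).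
Proof.
move=> f g /matrixP fg; apply/ffunP => i; have := fg i (f i).
rewrite !mxE eqxx; case: (g i =P f i) => [->//|_] /eqP.
by rewrite oner_eq0.
Qed.

Lemma fun_mx1 (R : pzSemiRingType) (n : nat) : fun_mx R [ffun i : 'I_n => i] = 1.
Proof. by apply/matrixP => i j; rewrite !mxE ffunE. Qed.

Lemma fun_mxM (R : pzSemiRingType) (n : nat) (f g : {ffun 'I_n -> 'I_n}) :
  fun_mx R f *m fun_mx R g = fun_mx R (ffun_comp g f).
Proof.
apply/matrixP => i j; rewrite !mxE ffunE (bigD1 (f i))//= !mxE eqxx mul1r.
by rewrite big1 ?addr0// => k; rewrite !mxE eq_sym => /negPf->; rewrite mul0r.
Qed.

Lemma binary_stochastic_fun (R : realType) (n : nat) (W : 'M[R]_n) :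
  binary_stochastic W -> exists f, W = fun_mx R f.
Proof.
move=> [W01 Wex]; have /choice[f hf] i : exists j, W i j = 1.
  by have [j []] := Wex i; exists j.
exists [ffun i => f i]; apply/matrixP => i j; rewrite mxE ffunE.
case: eqP => [<-//|fj]; have [//|Wij] := W01 i j.
by have [k [_ kuniq]] := Wex i; case: fj; rewrite -(kuniq _ (hf i)); exact: kuniq.
Qed.

Lemma prod_indicator (R : comPzSemiRingType) (I : finType) (P : pred I) :
  \prod_i (P i)%:R = [forall i, P i]%:R :> R.
Proof.
have [/forallP all_P|/forallPn[i /negPf Pi]] := boolP [forall i, P i].
  by rewrite big1// => i _; rewrite all_P.
by rewrite (bigD1 i)//= Pi mul0r.
Qed.

Lemma ksub_elt_inj n l (I : ksub n l) : injective (ksub_elt I).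
Proof. by move=> a b /enum_val_inj /cast_ord_inj. Qed.

Lemma ksub_elt_in n l (I : ksub n l) a : ksub_elt I a \in val I.
Proof. exact: enum_valP. Qed.

Lemma ksub_elt_onto n l (I : ksub n l) x : x \in val I -> exists a, ksub_elt I a = x.
Proof.
move=> xI; exists (cast_ord (eqP (valP I)) (enum_rank_in xI x)).
by rewrite /ksub_elt cast_ordK enum_rankK_in.
Qed.

(** The permanent counts the bijections [I -> J] whose graph lies in that of
    [f]; since both sets have [l] elements there is one exactly when [f] maps
    [I] onto [J], and it is then the restriction of [f]. *)
Lemma zeon_power_fun (R : comPzRingType) (n l : nat)
    (f : {ffun 'I_n -> 'I_n}) p q :
  zeon_power (fun_mx R f) l p q = (f @: val (enum_val p) == val (enum_val q))%:R.
Proof.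
rewrite mxE /permanent; set I := enum_val p; set J := enum_val q.
under eq_bigr do under eq_bigr do rewrite !mxE.
under eq_bigr do rewrite prod_indicator.
case: eqP => [fIJ|fIJ].
- have /choice[t ft] a : exists b, ksub_elt J b = f (ksub_elt I a).
    apply: ksub_elt_onto.
    by rewrite -fIJ imset_f// ksub_elt_in.
  have finj : {in val I &, injective f}.
    by apply/imset_injP; rewrite fIJ (eqP (valP I)) (eqP (valP J)).
  have tinj : injective t.
    move=> a b /(congr1 (ksub_elt J)); rewrite !ft => /finj fab.
    by apply: (@ksub_elt_inj _ _ I); apply: fab; exact: ksub_elt_in.
  rewrite (bigD1 (perm tinj))//= big1 => [|s sP].
    rewrite addr0; congr (_%:R); apply/eqP; rewrite eqb1; apply/forallP => a.
    by rewrite permE ft.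
  case: forallP => // fs; case/eqP: sP; apply/permP => a.
  by apply: (@ksub_elt_inj _ _ J); rewrite permE ft; exact/esym/eqP.
- rewrite big1// => s _; case: forallP => // fs; case: fIJ.
  have sub : f @: val I \subset val J.
    apply/fintype.subsetP => _ /imsetP[x /ksub_elt_onto[a <-] ->].
    by rewrite (eqP (fs a)) ksub_elt_in.
  apply/eqP; rewrite finset.eqEsubset sub; apply/fintype.subsetP => y /ksub_elt_onto[b <-].
  have -> : b = s (s^-1%g b) by rewrite permKV.
  by rewrite -(eqP (fs _)) imset_f// ksub_elt_in.
Qed.

Lemma zeon_power1 (R : comPzRingType) (n l : nat) :
  zeon_power (1 : 'M[R]_n) l = 1.
Proof.
rewrite -fun_mx1; apply/matrixP => p q; rewrite zeon_power_fun mxE; congr (_%:R).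
have -> : [ffun i : 'I_n => i] @: val (enum_val p) = val (enum_val p).
  by rewrite -[RHS]imset_id; apply: eq_imset => x; rewrite ffunE.
by rewrite (inj_eq val_inj) (inj_eq enum_val_inj).
Qed.

(** Permanents are not multiplicative in general; for functions the product is
    that of the induced partial maps on [l]-subsets, where a set that shrinks
    under [f] contributes zero on both sides. *)
Lemma zeon_power_funM (R : comPzRingType) (n l : nat) (f g : {ffun 'I_n -> 'I_n}) :
  zeon_power (fun_mx R f) l *m zeon_power (fun_mx R g) l
    = zeon_power (fun_mx R f *m fun_mx R g) l.
Proof.
rewrite fun_mxM; apply/matrixP => p q; rewrite zeon_power_fun mxE.
under eq_bigr do rewrite !zeon_power_fun.
set I := val (enum_val p); set L := val (enum_val q).
have -> : ffun_comp g f @: I = g @: (f @: I).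
  by rewrite -imset_comp; apply: eq_imset => x; rewrite ffunE.
have [fIl|fIl] := boolP (#|f @: I| == l).
  pose J : ksub n l := Sub (f @: I) fIl.
  rewrite (bigD1 (enum_rank J))//= enum_rankK eqxx mul1r big1 ?addr0// => r rJ.
  case: eqP => [fIr|_]; last by rewrite mul0r.
  by case/eqP: rJ; rewrite -[r]enum_valK; congr enum_rank; exact/val_inj/esym.
rewrite big1 => [|r _]; last first.
  by case: eqP => [fIr|_]; rewrite ?mul0r//; case/negP: fIl; rewrite fIr (valP (enum_val r)).
case: eqP => // gfI; case/negP: fIl; rewrite eqn_leq.
have Il : #|I| = l by exact/eqP/(valP (enum_val p)).
rewrite -{1}Il leq_imset_card/=.
have <- : #|L| = l by exact/eqP/(valP (enum_val q)).
by rewrite -gfI leq_imset_card.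
Qed.

(** * The random walk on the generated semigroup *)

(** Matrices act on row vectors, so multiplying on the right by the matrix of
    [c i] means composing on the left with [c i]. *)
Definition postcomp (n d : nat) (c : 'I_d -> {ffun 'I_n -> 'I_n})
    (f : {ffun 'I_n -> 'I_n}) (i : 'I_d) : {ffun 'I_n -> 'I_n} :=
  ffun_comp (c i) f.

Definition ffun_id (n : nat) : {ffun 'I_n -> 'I_n} := [ffun i => i].

Lemma fun_mx_foldl (R : pzSemiRingType) (n d : nat)
    (c : 'I_d -> {ffun 'I_n -> 'I_n}) f (s : seq 'I_d) :
  fun_mx R (foldl (postcomp c) f s) = fun_mx R f *m \prod_(i <- s) fun_mx R (c i).
Proof.
elim: s f => [|i s IH] f; first by rewrite big_nil mulmx1.
by rewrite big_cons /= IH -fun_mxM -mulmxA.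
Qed.

(** Sums over sets of matrices become sums over the finite type of functions that
    the matrices come from. *)
Lemma fsbig_range (V : nmodType) (T : finType) (J : choiceType) (h : T -> J)
    (Q : set J) (G : J -> V) : injective h -> Q `<=` range h ->
  \sum_(j \in Q) G j = \sum_(t | h t \in Q) G (h t).
Proof.
move=> hinj Qh; have -> : Q = h @` [set t | h t \in Q].
  apply/seteqP; split=> [j Qj|_ [t /set_mem Qt <-]//].
  by have [t _ tj] := Qh j Qj; exists t => //=; rewrite tj inE.
rewrite fsbig_image => [|s t _ _ /hinj//].
rewrite [RHS]bigfs ?index_enum_uniq// => [|t _ /negP[]]; last exact: mem_index_enum.
apply: eq_fsbigl; apply/seteqP; split=> t /=.
  by move=> Qt; apply/mem_set; exists t.
by move=> /set_mem[u Qu /hinj <-].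
Qed.

Lemma mu1_fun (R : realType) (n d : nat) (c : 'I_d -> {ffun 'I_n -> 'I_n}) g :
  mu1 (fun i => fun_mx R (c i)) (fun_mx R g)
    = d%:R^-1 * \sum_(i < d) (c i == g)%:R.
Proof.
rewrite /mu1; congr (_ * _); rewrite -sum1_card natr_sum big_mkcond.
apply: eq_bigr => i _; rewrite inE (inj_eq (@fun_mx_inj R n)).
by case: eqP.
Qed.

Lemma walk_in_semigroup (R : realType) (n d : nat)
    (c : 'I_d -> {ffun 'I_n -> 'I_n}) m y :
  walk R (postcomp c) m.+1 (ffun_id n) y != 0 ->
  gen_semigroup (fun i => fun_mx R (c i)) (fun_mx R y).
Proof.
move=> /walk_reach[s [sm ->]]; exists s; split; first by case: s sm.
by rewrite fun_mx_foldl fun_mx1 mul1mx.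
Qed.

Lemma semigroup_range (R : realType) (n d : nat)
    (c : 'I_d -> {ffun 'I_n -> 'I_n}) :
  gen_semigroup (fun i => fun_mx R (c i)) `<=` range (@fun_mx R n).
Proof.
move=> _ [s [_ ->]]; exists (foldl (postcomp c) (ffun_id n) s) => //.
by rewrite fun_mx_foldl fun_mx1 mul1mx.
Qed.

(** The convolution runs over factorisations inside the semigroup; this is no
    restriction, since both factors carry mass only on the semigroup. *)
Lemma mu_walk (R : realType) (n d : nat) (c : 'I_d -> {ffun 'I_n -> 'I_n}) m y :
  mu (fun i => fun_mx R (c i)) m.+1 (fun_mx R y)
    = walk R (postcomp c) m.+1 (ffun_id n) y.
Proof.
set C := fun i : 'I_d => fun_mx R (c i); rewrite /mu /=; elim: m y => [|m IH] y.
  rewrite walkS (bigD1 (ffun_id n))//= walk0 eqxx mul1r big1 ?addr0 => [|z].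
    rewrite mu1_fun /step; congr (_ * _); apply: eq_bigr => i _; congr (_ == _)%:R.
    by apply/ffunP => a; rewrite !ffunE.
  by rewrite walk0 eq_sym => /negPf->; rewrite mul0r.
rewrite iterS; set nu := iter m _ _ in IH *; rewrite /convolution.
pose h (fg : {ffun 'I_n -> 'I_n} * {ffun 'I_n -> 'I_n}) :=
  (fun_mx R fg.1, fun_mx R fg.2).
have hinj : injective h.
  by move=> [f g] [f' g'] [/fun_mx_inj -> /fun_mx_inj ->].
rewrite (fsbig_range _ hinj); last first.
  move=> [u v] [/= /semigroup_range[f _ <-] /semigroup_range[g _ <-] _].
  by exists (f, g).
(* The constraints that [f] and [g] lie in the semigroup are absorbed by the
   vanishing of [nu] and [mu1]. *)
transitivity (\sum_fg nu (h fg).1 * mu1 C (h fg).2 *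
    (ffun_comp fg.2 fg.1 == y)%:R).
  rewrite big_mkcond; apply: eq_bigr => -[f g] _ /=; case: ifPn.
    move=> /set_mem[_ _] /=; rewrite fun_mxM => /fun_mx_inj ->.
    by rewrite eqxx mulr1.
  move=> /negP nD; apply/esym/eqP; apply/negPn/negP.
  rewrite mulf_eq0 negb_or => /andP[+ gfy].
  rewrite mulf_eq0 negb_or => /andP[nuf mug]; apply: nD.
  apply/mem_set; split=> /=.
  - by apply: (@walk_in_semigroup R n d c m); rewrite -IH.
  - have [/existsP[i /eqP <-]|no] := boolP [exists i, c i == g].
      by exists [:: i]; rewrite big_seq1.
    case/eqP: mug; rewrite mu1_fun big1 ?mulr0// => i _.
    by move: no; rewrite negb_exists => /forallP/(_ i)/negPf->.
  - by rewrite fun_mxM; move: gfy; rewrite pnatr_eq0 eqb0 negbK => /eqP ->.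
rewrite walkS -(pair_bigA _ (fun f g => nu (fun_mx R f) * mu1 C (fun_mx R g) *
  (ffun_comp g f == y)%:R))/=.
apply: eq_bigr => f _; rewrite -IH.
under eq_bigr do rewrite -mulrA.
rewrite -mulr_sumr /step; congr (_ * _).
under eq_bigr do rewrite mu1_fun -mulrA mulr_suml.
rewrite -mulr_sumr exchange_big; congr (_ * _); apply: eq_bigr => i _.
rewrite (bigD1 (c i))//= eqxx mul1r big1 ?addr0// => g.
by rewrite eq_sym => /negPf->; rewrite mul0r.
Qed.

Lemma zeon_mean_expr (R : realType) (n d l : nat)
    (c : 'I_d -> {ffun 'I_n -> 'I_n}) m :
  (\sum_(i < d) d%:R^-1 *: zeon_power (fun_mx R (c i)) l) ^+ m
    = \sum_f walk R (postcomp c) m (ffun_id n) f *: zeon_power (fun_mx R f) l.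
Proof.
elim: m => [|m IH].
  rewrite expr0 (bigD1 (ffun_id n))//= walk0 eqxx scale1r fun_mx1 zeon_power1.
  rewrite big1 ?addr0// => f; rewrite walk0 eq_sym => /negPf->.
  by rewrite scale0r.
rewrite exprSr IH; under [RHS]eq_bigr do rewrite walkS.
rewrite sum_step [LHS]mulmx_suml; apply: eq_bigr => f _.
rewrite -scaler_sumr -scalemxAl -scalemxAr mulmx_sumr; congr (_ *: (_ *: _)).
by apply: eq_bigr => i _; rewrite zeon_power_funM fun_mxM.
Qed.

(** * Cesaro limit of the powers of [A_l] *)

Theorem proposition9p8 (R : realType) (n d : nat) (Adj : 'M[nat]_n)
    (A : 'M[R]_n) (C : 'I_d -> 'M[R]_n) (K : set 'M[R]_n) (l : nat)
    (d_gt0 : (0 < d)%N)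
    (Adj_regular : forall i, (\sum_(j < n) Adj i j)%N = d)
    (A_def : A = d%:R^-1 *: map_mx (fun k : nat => k%:R) Adj)
    (A_irr : irreducible_mx A)
    (A_aper : aperiodic_mx A)
    (C_bin : forall i, binary_stochastic (C i))
    (A_col : A = d%:R^-1 *: \sum_(i < d) C i)
    (K_ker : minimal_ideal (gen_semigroup C) K)
    (l_bounds : (1 <= l <= n)%N) :
  let A_l := \sum_(i < d) d%:R^-1 *: zeon_power (C i) l in
  (fun M : nat => M%:R^-1 *: \sum_(1 <= m < M.+1) A_l ^+ m) @ \oo
    --> kernel_average C K (fun k => zeon_power k l).
Proof.
move=> A_l; have /choice[c cE] : forall i, exists f, C i = fun_mx R f.
  by move=> i; exact: binary_stochastic_fun.
have {cE}CE : C = fun i => fun_mx R (c i) by apply/funext.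
move: @A_l K_ker; rewrite {}CE {A_irr A_aper A_col A_def C_bin C}.
set C := fun i : 'I_d => fun_mx R (c i); move=> A_l [[[k0 Kk0] KS Kideal] _].
have [pi [pi_ge0 pi_inv pi_lim]] := walk_mean_cvg R (postcomp c) (ffun_id n) d_gt0.
have lambdaE f : lambda C (fun_mx R f) = pi f.
  rewrite /lambda; apply: cvg_lim => //; rewrite -[X in X @ _](_ : (fun M : nat =>
    M%:R^-1 * \sum_(1 <= m < M.+1) walk R (postcomp c) m (ffun_id n) f) = _).
    exact: pi_lim.
  apply/funext => M; congr (_ * _); apply: eq_big_nat => -[|m]// _.
  by rewrite mu_walk.
have pi_S f : pi f != 0 -> gen_semigroup C (fun_mx R f).
  move=> /eqP pif; apply: contrapT => nS; apply: pif; rewrite -(cvg_lim _ (pi_lim f))//.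
  rewrite [X in X @ _](_ : _ = cst 0) ?lim_cst//.
  apply/funext => M; rewrite big_nat big1 ?mulr0// => -[|m]// _.
  by apply/eqP/negPn/negP => /walk_in_semigroup.
(* A word for some [k0] in [K] leads from any [g] in the semigroup to [g k0],
   which lies in [K]. *)
have pi_K f : pi f != 0 -> fun_mx R f \in K.
  apply: (invariant_supported (K := fun f => fun_mx R f \in K) d_gt0 pi_ge0 pi_inv).
    move=> g i /set_mem Kg; apply/mem_set; rewrite -fun_mxM.
    have SCi : gen_semigroup C (C i) by exists [:: i]; rewrite big_seq1.
    by have [] := Kideal _ _ SCi Kg.
  move=> g /pi_S Sg; have [s [_ k0E]] := KS _ Kk0.
  exists s; apply/mem_set; rewrite fun_mx_foldl -k0E.
  by have [] := Kideal _ _ Sg Kk0.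
have -> : kernel_average C K (fun k => zeon_power k l)
    = \sum_f pi f *: zeon_power (fun_mx R f) l.
  rewrite /kernel_average (fsbig_range _ (@fun_mx_inj R n)); last first.
    by move=> k /KS; exact: semigroup_range.
  rewrite big_mkcond; apply: eq_bigr => f _; rewrite lambdaE; case: ifPn => // nK.
  by rewrite (contraNeq (pi_K f))// scale0r.
rewrite [X in X @ _](_ : _ = fun M => \sum_f (M%:R^-1 * \sum_(1 <= m < M.+1)
    walk R (postcomp c) m (ffun_id n) f) *: zeon_power (fun_mx R f) l).
  apply: cvg_big => [|f _]; first exact: add_continuous.
  exact: cvgZr_tmp (pi_lim f).
apply/funext => M; under eq_bigr do rewrite zeon_mean_expr.
rewrite exchange_big scaler_sumr; apply: eq_bigr => f _.
by rewrite -scaler_suml scalerA.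
Qed.
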